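(* Let $g,n\ge 0$ be integers with $2g-2+n>0$. Then $$D\chi_{g,n}=(n+1)\,\chi_{g,n+1},\qquad\text{where}\quad D\chi_{g,n}:=\Big(\frac{\partial}{\partial t}+\kappa^2t^{-1}\frac{\partial}{\partial\kappa}+n\,\kappa t^{-1}\Big)\chi_{g,n}.$$ Equivalently, for every $i\ge 0$, $$(n+1)\,a_{g,n+1}^{i}=(2-2g-n)\,a_{g,n}^{i}+(n+i-1)\,a_{g,n}^{i-1},$$ where $a_{g,n}^{j}:=0$ if $j<0$ or $j>3g-3+n$.
   Context: Stable graphs: a stable graph is a finite graph (loops and multiple edges allowed) with internal edges, each joining two (possibly equal) vertices, and unlabelled external edges, each attached to one vertex. Each vertex $v$ carries a genus $g_v\in\mathbb Z_{\ge0}$; its valence $\mathrm{val}_v$ is the number of half-edges at $v$ (an external edge counts once, a loop twice); stability means $2g_v-2+\mathrm{val}_v>0$ for every $v$. The genus of a connected stable graph $\Gamma$ is $h^1(\Gamma)+\sum_v g_v$. $\mathcal G^c_{g,n}$ is the (finite) set of isomorphism classes of connected stable graphs of genus $g$ with $n$ external edges, $V(\Gamma)$ and $E(\Gamma)$ are the sets of vertices and internal edges, and $\mathrm{Aut}(\Gamma)$ is the automorphism group (acting on vertices and half-edges; external edges may be permuted). For $2g-2+n>0$, $\chi(\mathcal M_{g,n})$ is the orbifold Euler characteristic of the moduli space of smooth genus $g$ curves with $n$ marked points, given by the Harer–Zagier formula $\chi(\mathcal M_{g,n})=(-1)^n\frac{(2g-1)B_{2g}}{(2g)!}(2g+n-3)!$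 ($B_{2g}$ the Bernoulli numbers). The refined orbifold Euler characteristic, with $t,\kappa$ independent formal variables, is $$\chi_{g,n}(t,\kappa):=\sum_{\Gamma\in\mathcal G^c_{g,n}}\frac{\kappa^{|E(\Gamma)|}}{|\mathrm{Aut}(\Gamma)|}\prod_{v\in V(\Gamma)}\chi(\mathcal M_{g_v,\mathrm{val}_v})\,t^{2-2g_v-\mathrm{val}_v}.$$ Put $\widetilde\chi_{g,n}(\kappa):=\chi_{g,n}(1,\kappa)$, a polynomial of degree $3g-3+n$ in $\kappa$, and write $\widetilde\chi_{g,n}(\kappa)=\sum_{i=0}^{3g-3+n}a_{g,n}^i\kappa^i$. *)

(* Defs.v *)
From HB Require Import structures.
From mathcomp Require Import all_boot all_order all_algebra all_fingroup.
From mathcomp Require Import generic_quotient fraction zify ring.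
From mathcomp Require Import all_classical.

Set Implicit Arguments.
Unset Strict Implicit.
Unset Printing Implicit Defensive.

Import Order.TTheory GRing.Theory Num.Theory.

Local Open Scope ring_scope.
Local Open Scope quotient_scope.

(* A graph with vertex set V and half-edge set H: every half-edge is attached
   to a vertex, and an involution [flip] pairs half-edges.  The two-element
   orbits of [flip] are the internal edges (loops and multiple edges allowed),
   its fixed points are the external edges. *)
Section GraphOn.
Variables V H : finType.

Definition flip_involutive
    (d : {ffun H -> V} * {ffun H -> H} * {ffun V -> nat}) : bool :=
  [forall h, d.1.2 (d.1.2 h) == h].

Record graph_on := GraphOn {
  graph_data : {ffun H -> V} * {ffun H -> H} * {ffun V -> nat};
  graph_dataP : flip_involutive graph_data }.

HB.instance Definition _ := [isSub for graph_data].
HB.instance Definition _ := [Countable of graph_on by <:].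

Definition vertex_of (G : graph_on) : H -> V := (graph_data G).1.1.
Definition flip (G : graph_on) : H -> H := (graph_data G).1.2.
Definition vgenus (G : graph_on) : V -> nat := (graph_data G).2.

Lemma flipK G : involutive (flip G).
Proof. by move=> h; apply/eqP; move/forallP: (graph_dataP G); apply. Qed.

Variable G : graph_on.

Definition edges : {set {set H}} :=
  [set [set h; flip G h] | h in [set h | flip G h != h]].
Definition legs : {set H} := [set h | flip G h == h].
Definition valence (v : V) : nat := #|[set h | vertex_of G h == v]|.

Definition adjacent : rel V :=
  fun u v => [exists h, (vertex_of G h == u) && (vertex_of G (flip G h) == v)].
Definition gconnected : bool :=
  (0 < #|V|)%N && [forall u, forall v, connect adjacent u v].

Definition gstable : bool :=
  [forall v, (2 < 2 * vgenus G v + valence v)%N].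

(* First Betti number |E| - |V| + 1 of a connected graph; the graphs on which
   it is used below are all connected.  It is an int, so nothing truncates. *)
Definition h1 : int := #|edges|%:Z - #|V|%:Z + 1.
Definition genus : int := h1 + (\sum_v vgenus G v)%:Z.

Definition Aut_graph : {set {perm V} * {perm H}} :=
  [set s : {perm V} * {perm H} |
    [&& [forall h, vertex_of G (s.2 h) == s.1 (vertex_of G h)],
        [forall h, flip G (s.2 h) == s.2 (flip G h)]
      & [forall v, vgenus G (s.1 v) == vgenus G v]]].

End GraphOn.

Lemma card_halfedges (V H : finType) (G : graph_on V H) :
  #|H| = (2 * #|edges G| + #|legs G|)%N.
Proof.
have oK := flipK G.
rewrite -(cardC (mem (legs G))) addnC; congr (_ + _)%N.
rewrite (eq_card (B := mem [set h | flip G h != h])); last by move=> h; rewrite !inE.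
rewrite mulnC; apply: card_uniform_partition.
  move=> A /imsetP[h]; rewrite inE => ho ->; rewrite cards2 eq_sym.
  by move: ho; case: eqP.
apply/and3P; split.
- apply/eqP/setP => h; apply/bigcupP/idP => [[A /imsetP[k]]|].
    by rewrite !inE => ko -> /set2P[]->; rewrite ?oK // eq_sym.
  by move=> ho; exists [set h; flip G h]; [exact: imset_f|rewrite set21].
- apply/finset.trivIsetP => A B /imsetP[h _ ->] /imsetP[k _ ->] AB.
  apply/pred0P => x /=; apply/negP => /andP[/set2P xh /set2P xk].
  case/eqP: AB.
  have S y : x = y \/ x = flip G y -> [set x; flip G x]%SET = [set y; flip G y]%SET.
    by case=> -> //; rewrite oK finset.setUC.
  by rewrite -(S h) // -(S k).
- apply/negP => /imsetP[h _ /setP/(_ h)]; by rewrite !inE eqxx.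
Qed.

Lemma sum_valence (V H : finType) (G : graph_on V H) :
  (\sum_v valence G v)%N = #|H|.
Proof.
rewrite -sum1_card (partition_big (vertex_of G) xpredT) //=.
by apply: eq_bigr => v _; rewrite sum1dep_card; apply: eq_card => h; rewrite !inE.
Qed.

Definition isomorphic (V H V' H' : finType)
    (G : graph_on V H) (G' : graph_on V' H') : Prop :=
  exists (f : V -> V') (k : H -> H'),
    [/\ bijective f, bijective k,
        forall h, vertex_of G' (k h) = f (vertex_of G h),
        forall h, flip G' (k h) = k (flip G h)
      & forall v, vgenus G' (f v) = vgenus G v].

(* Every finite graph is isomorphic to one whose vertices and half-edges are
   ordinals; those form a small type, which is quotiented by isomorphism. *)
Definition graph_type (d : nat * nat) : choiceType :=
  graph_on 'I_d.1 'I_d.2.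
Definition fin_graph : choiceType := {d : nat * nat & graph_type d}.

Definition iso_rel (G G' : fin_graph) : bool :=
  `[< isomorphic (tagged G) (tagged G') >].

Lemma iso_refl : reflexive iso_rel.
Proof.
move=> G; apply/asboolP; exists id, id; split=> //; by exists id.
Qed.

Lemma iso_sym : symmetric iso_rel.
Proof.
suff iS G G' : iso_rel G G' -> iso_rel G' G by move=> G G'; apply/idP/idP=> /iS.
move=> /asboolP[f [k [[f' fK f'K] [k' kK k'K] hr ho hg]]].
apply/asboolP; exists f', k'; split; first by exists f.
- by exists k.
- by move=> h; rewrite -{2}(k'K h) hr fK.
- by move=> h; rewrite -{2}(k'K h) ho kK.
- by move=> v; rewrite -{2}(f'K v) hg.
Qed.

Lemma iso_trans : transitive iso_rel.
Proof.
move=> G2 G1 G3 /asboolP[f [k [bf bk hr ho hg]]].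
move=> /asboolP[f' [k' [bf' bk' hr' ho' hg']]].
apply/asboolP; exists (f' \o f), (k' \o k); split=> /=.
- exact: bij_comp.
- exact: bij_comp.
- by move=> h; rewrite hr' hr.
- by move=> h; rewrite ho' ho.
- by move=> v; rewrite hg' hg.
Qed.

Canonical iso_equiv := EquivRel iso_rel iso_refl iso_sym iso_trans.
Definition graph_class : choiceType := {eq_quot iso_rel}.

Definition class_repr (c : graph_class) : fin_graph := repr c.

Definition in_Gc (g n : nat) (G : fin_graph) : bool :=
  [&& gconnected (tagged G), gstable (tagged G), genus (tagged G) == g%:Z
    & #|legs (tagged G)| == n].

(* The set of isomorphism classes of connected stable graphs of genus g with n
   external edges. *)
Definition Gc (g n : nat) : set graph_class :=
  [set c | in_Gc g n (class_repr c)]%classic.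

(* Finiteness of G^c_{g,n}: a sum over [Gc g n] is a genuine finite sum. *)
Lemma in_Gc_bounds g n (G : fin_graph) : in_Gc g n G ->
  [/\ (#|'I_(tag G).1| + 2 <= 2 * g + n)%N, 
     (#|edges (tagged G)| + 3 <= 3 * g + n)%N &
     forall v, (vgenus (tagged G) v + 3 <= 3 * g + n)%N].
Proof.
case: G => [[k m] G]; rewrite /in_Gc /=.
case/and4P=> /andP[k0 _] /forallP st /eqP gn /eqP ln.
have cH := card_halfedges G; have sv := sum_valence G.
have kk : (3 * #|'I_k| <= \sum_v (2 * vgenus G v + valence G v))%N.
  by rewrite mulnC -sum_nat_const; apply: leq_sum => v _; exact: st.
rewrite big_split /= -big_distrr /= sv cH ln in kk.
have sg v : (vgenus G v <= \sum_v vgenus G v)%N by rewrite (bigD1 v) //= leq_addr.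
rewrite /genus /h1 in gn; move: gn kk sg k0.
move: (\sum_v vgenus G v)%N #|edges G| #|'I_k| => S E K gn kk sg k0.
split; [lia|lia|move=> v; apply: (@leq_trans (S + 3)); first by rewrite leq_add2r]. lia.
Qed.

Lemma finite_bounded_graphs (k m B : nat) :
  finite_set [set G : graph_on 'I_k 'I_m | forall v, (vgenus G v < B)%N]%classic.
Proof.
set S := (X in finite_set X).
have [[G0 SG0]|nS] := pselect (exists G, S G); last first.
  by rewrite (_ : S = set0)%classic //; apply/seteqP; split=> // G SG; case: nS; exists G.
pose f (d : {ffun 'I_m -> 'I_k} * {ffun 'I_m -> 'I_m} * {ffun 'I_k -> 'I_B}) :=
  insubd G0 (d.1, [ffun v => d.2 v : nat]).
apply: (@sub_finite_set _ _ (range f)); last exact/finite_image/finite_finset.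
move=> G SG; exists ((graph_data G).1, [ffun v => Ordinal (SG v)]) => //.
apply: val_inj; rewrite /f val_insubd.
set d := (X in flip_involutive X).
have dE : d = val G.
  rewrite /d [RHS]surjective_pairing; congr (_, _) => /=.
  by apply/ffunP => v; rewrite !ffunE.
by rewrite ifT; [exact: dE|rewrite dE; exact: (valP G)].
Qed.

Lemma finite_Gc g n : finite_set (Gc g n).
Proof.
pose N := (2 * (3 * g + n) + n)%N.
pose S := (\bigcup_(k in `I_N.+1) \bigcup_(m in `I_N.+1)
  ((fun G => existT graph_type (k, m) G : fin_graph) @`
     [set G : graph_on 'I_k 'I_m | forall v, (vgenus G v < N)%N]))%classic.
have fS : finite_set S.
  apply: bigcup_finite => // k _; apply: bigcup_finite => // m _.
  exact/finite_image/finite_bounded_graphs.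
apply: sub_finite_set (finite_image (\pi_graph_class)%qT fS).
move=> c; rewrite /Gc /= => cG; exists (class_repr c); last exact: reprK.
move: (class_repr c) cG => {c} G cG.
have [bk bE bg] := in_Gc_bounds cG.
have cH := card_halfedges (tagged G).
case/and4P: cG => _ _ _ /eqP ln; rewrite ln in cH.
move: G bk bE bg cH {ln} => [[k m] G] /= bk bE bg cH.
rewrite !card_ord in bk cH; rewrite /S /N.
exists k; [by rewrite /=; lia|exists m; first by rewrite /=; lia].
by exists G => //= v; have := bg v; lia.
Qed.

Fixpoint bernoulli_seq (n : nat) : seq rat :=
  if n is m.+1 then
    let s := bernoulli_seq m in
    rcons s ((m == 0)%:R - \sum_(k < m) 'C(m, k)%:R * s`_k / (m - k).+1%:R)
  else [::].
Definition bernoulli (n : nat) : rat := (bernoulli_seq n.+1)`_n.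

Lemma size_bernoulli_seq n : size (bernoulli_seq n) = n.
Proof. by elim: n => //= n IH; rewrite size_rcons IH. Qed.

Lemma nth_bernoulli_seq n k : (k < n)%N -> (bernoulli_seq n)`_k = bernoulli k.
Proof.
elim: n => // n IH; rewrite ltnS leq_eqVlt => /orP[/eqP->//|lt_kn].
by rewrite /= nth_rcons size_bernoulli_seq lt_kn IH.
Qed.

Lemma bernoulliE n :
  \sum_(k < n.+1) 'C(n.+1, k)%:R * bernoulli k = (n == 0)%:R.
Proof.
rewrite big_ord_recr /= binSn {2}/bernoulli /= nth_rcons size_bernoulli_seq.
rewrite ltnn eqxx mulrBr.
have -> : n.+1%:R * (n == 0)%:R = (n == 0)%:R :> rat.
  by case: n => [|n] /=; rewrite ?mulr1 ?mulr0.
rewrite [X in _ + (_ - X)](_ : _ = \sum_(k < n) 'C(n.+1, k)%:R * bernoulli k).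
  by rewrite addrC subrK.
rewrite mulr_sumr; apply: eq_bigr => k _.
rewrite nth_bernoulli_seq // !mulrA mulrAC; congr (_ * _).
apply: (mulIf (x := (n - k).+1%:R)); first by rewrite pnatr_eq0.
rewrite mulfVK ?pnatr_eq0 // -!natrM; congr (_%:R).
by rewrite [RHS]mulnC -subSn ?(ltnW (ltn_ord k)) // -mul_bin_down mulnC mulnC.
Qed.

(* Harer-Zagier; meaningful for 2g - 2 + n > 0, where the truncated
   subtraction is an honest one. *)
Definition chiM (g n : nat) : rat :=
  (-1) ^+ n * ((2 * g%:R - 1) * bernoulli (2 * g) / (2 * g)`!%:R)
  * (2 * g + n - 3)`!%:R.

(* [chi t g n] is chi_{g,n}(t, kappa) as a polynomial in kappa = 'X, for t in a
   field of characteristic 0: t is the variable of Q(t) in [chi_tk], and is set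
   to 1 in [tchi].  [ratr] is the inclusion of Q. *)
Definition graph_weight (F : fieldType) (t : F) (G : fin_graph) : {poly F} :=
  ((#|Aut_graph (tagged G)|%:R)^-1
   * \prod_v (ratr (chiM (vgenus (tagged G) v) (valence (tagged G) v))
              * t ^ (2 - 2 * (vgenus (tagged G) v)%:Z
                       - (valence (tagged G) v)%:Z)))
  *: 'X^#|edges (tagged G)|.

Definition chi (F : fieldType) (t : F) (g n : nat) : {poly F} :=
  \sum_(c \in Gc g n) graph_weight t (class_repr c).

Definition Qt : fieldType := {fraction {poly rat}}.
Definition tvar : Qt := FracField.tofrac 'X.
Definition chi_tk (g n : nat) : {poly Qt} := chi tvar g n.

(* d/dt on Q(t), by the quotient rule (see fderivE). *)
Definition fderiv (x : Qt) : Qt :=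
  let p : {poly rat} := \n_(repr x) in
  let q : {poly rat} := \d_(repr x) in
  FracField.tofrac (p^`() * q - p * q^`()) / FracField.tofrac (q ^+ 2).

Lemma fderiv_cross (R : idomainType) (a b p q a' b' p' q' : R) :
  p * b = a * q -> p' * b + p * b' = a' * q + a * q' ->
  (p' * q - p * q') * b ^+ 2 = (a' * b - a * b') * q ^+ 2.
Proof.
move=> pb dpb.
have e1 : p' * b = a' * q + a * q' - p * b' by rewrite -dpb addrK.
transitivity ((p' * b) * (q * b) - (p * b) * (b * q')); first by ring.
rewrite e1 pb.
transitivity ((a' * q + a * q') * (q * b) - (p * b) * (q * b') - a * q * (b * q')).
  by ring.
by rewrite pb; ring.
Qed.

Lemma tofrac_div_eq (a b p q : {poly rat}) : b != 0 -> q != 0 ->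
  (FracField.tofrac a / FracField.tofrac b ==
   FracField.tofrac p / FracField.tofrac q) = (p * b == a * q).
Proof.
move=> b0 q0; rewrite eqr_div ?tofrac_eq0 //.
by rewrite -(tofracM a q) -(tofracM p b) tofrac_eq eq_sym.
Qed.

Lemma fracE (x : Qt) :
  x = FracField.tofrac \n_(repr x) / FracField.tofrac \d_(repr x).
Proof.
rewrite -{1}[x]reprK; move: (repr x) => r.
change (\pi_Qt r = FracField.mul (FracField.tofrac \n_r) (FracField.inv (FracField.tofrac \d_r)))%qT.
rewrite !piE /FracField.mulf /FracField.invf.
rewrite !numden_Ratio ?oner_neq0 // ?denom_ratioP //.
by rewrite mulr1 mul1r Ratio_numden.
Qed.

Lemma fderivE (a b : {poly rat}) : b != 0 ->
  fderiv (FracField.tofrac a / FracField.tofrac b)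
  = FracField.tofrac (a^`() * b - a * b^`()) / FracField.tofrac (b ^+ 2).
Proof.
move=> b0; have [x] : exists x : Qt, FracField.tofrac a / FracField.tofrac b = x by eexists.
move=> xE; rewrite xE /fderiv; move: xE; rewrite [in X in X -> _](fracE x); move: (denom_ratioP (repr x)) => q0 xE.
move: q0 xE; move: (\n_(repr x)) (\d_(repr x)) => p q q0 /esym/eqP.
rewrite tofrac_div_eq // => /eqP pb.
apply/eqP/(etrans (tofrac_div_eq _ _ (expf_neq0 2 q0) (expf_neq0 2 b0))).
by apply/eqP/esym/fderiv_cross => //; rewrite -!derivM pb.
Qed.

Definition D_t (P : {poly Qt}) : {poly Qt} := map_poly fderiv P.
Definition D_kappa (P : {poly Qt}) : {poly Qt} := P^`().

Definition Dop (n : nat) (P : {poly Qt}) : {poly Qt} :=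
  D_t P + 'X^2 * (tvar^-1)%:P * D_kappa P + n%:R * 'X * (tvar^-1)%:P * P.

Definition tchi (g n : nat) : {poly rat} := chi 1 g n.

(* The coefficient of kappa^j, with the convention that it is 0 outside
   0 <= j <= 3g - 3 + n (see tchiE). *)
Definition acoef (g n : nat) (j : int) : rat :=
  if (0 <= j) && (j <= 3 * g%:Z - 3 + n%:Z) then (tchi g n)`_`|j|%N else 0.

Lemma size_tchi g n : (size (tchi g n) <= (3 * g + n - 3).+1)%N.
Proof.
rewrite /tchi /chi fsbig_finite; last exact: finite_Gc.
rewrite big_seq; apply: (big_ind (fun p : {poly rat} => size p <= _)%N).
- by rewrite size_poly0.
- by move=> p q sp sq; rewrite (leq_trans (size_polyD _ _)) // geq_max sp.
move=> c; rewrite in_fset_set ?inE; last exact: finite_Gc.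
move=> /in_Gc_bounds[_ bE _].
by rewrite (leq_trans (size_scale_leq _ _)) // size_polyXn ltnS; lia.
Qed.

Lemma tchiE g n : (2 < 2 * g + n)%N ->
  tchi g n = \sum_(i < (3 * g + n - 3).+1) acoef g n i%:Z *: 'X^i.
Proof.
move=> hgn; rewrite -[LHS](take_poly_id (size_tchi g n)) /take_poly poly_def.
apply: eq_bigr => i _; rewrite /acoef ifT //.
by have := ltn_ord i; lia.
Qed.

(* Main.v *)
From HB Require Import structures.
Require Import Defs.
From mathcomp Require Import all_boot all_order all_algebra all_fingroup.
From mathcomp Require Import generic_quotient fraction zify ring lra.
From mathcomp Require boolp classical_sets cardinality fsbigop.

Set Implicit Arguments.
Unset Strict Implicit.
Unset Printing Implicit Defensive.

Import GRing.Theory Num.Theory.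
Local Open Scope ring_scope.

(** Forgetting the last marked point gives
    chi(M_{g,n+1}) = (2 - 2g - n) chi(M_{g,n}) ([chiMS]); the theorem is the
    version of this for sums over stable graphs, and it is proved by forgetting
    one of the n + 1 legs of a graph of type (g, n + 1).

    If the vertex of the leg stays stable, what remains is a graph of type
    (g, n) with a distinguished vertex v, and restoring the leg multiplies the
    weight by 2 - 2g_v - val_v. The sum of these Euler characteristics over all
    vertices is 2 - 2g - n, whatever the graph ([sum_add_leg]). Otherwise the
    vertex is [critical], of type (0,3) or (1,1). Since a vertex with no edge to
    another vertex is the whole of a connected graph, the hypothesis
    2g - 2 + n > 0 rules out type (1,1), a loop at the vertex, and two more legs
    at the vertex ([critical_not_closed]). So the vertex is trivalent of genus 0
    and, once the leg is forgotten, sits in the middle of an internal edge or of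
    an external edge; suppressing it leaves a graph of type (g, n) with one
    internal edge fewer and the same weight, as chi(M_{0,3}) = 1. A graph with i
    internal edges arises in i + n ways. Together,
    (n + 1) a_{n+1}^i = (2 - 2g - n) a_n^i + (n + i - 1) a_n^{i-1}.

    The automorphism factors disappear when isomorphism classes are replaced by
    graphs on fixed vertex and half-edge sets: a graph with k vertices and m
    half-edges has k! m! / |Aut| labellings ([card_labellings]), so that the
    coefficient of kappa^i is the sum over k of the number of labelled graphs,
    counted with weight and divided by k! m!, for m = 2i + n
    ([stable_mass_classes], [tchi_coef]). Restoring a leg is then a bijection
    between graphs on V and H and graphs on types made from V and H by [option];
    the distinguished half-edge or vertex is moved to [None] by symmetry
    ([sum_marked]).

    In the second case the two half-edges a and b of the trivalent vertex other
    than the leg are put in order, which counts every graph twice. If a is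
    attached to a half-edge h of the smaller graph, any of its 2i + n half-edges
    is possible for h ([sum_insert]); if a is itself a leg, then b is attached
    to one of the n legs. This makes 2i + 2n, twice i + n ([sum_tripod]).

    The exponent of t in the weight of a graph is always 2 - 2g - n
    ([graph_weightE]), so chi_{g,n}(t, kappa) = t^(2-2g-n) chi_{g,n}(1, kappa),
    and the differential equation is the recursion, coefficientwise. *)

(** * Stable graphs on arbitrary finite vertex and half-edge sets *)

Lemma connect_homo (T T' : finType) (e : rel T) (e' : rel T') (f : T -> T') :
  (forall a b, e a b -> connect e' (f a) (f b)) ->
  forall a b, connect e a b -> connect e' (f a) (f b).
Proof.
move=> ef a b /connectP[p]; elim: p a => [|c p IH] a /=; first by move=> _ ->.
by case/andP=> /ef ac /IH cb /cb; apply: connect_trans.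
Qed.

Definition stable_graph (V H : finType) (g n : nat) (G : graph_on V H) : bool :=
  [&& gconnected G, gstable G, genus G == g%:Z & #|legs G| == n].

Definition vweight (V H : finType) (G : graph_on V H) : rat :=
  \prod_v chiM (vgenus G v) (valence G v).

(** Counting half-edges turns the genus condition into an identity of natural
    numbers from which the number of edges is gone. *)
Lemma genusE (V H : finType) (G : graph_on V H) (g : nat) :
  (genus G == g%:Z) =
  (2 + #|H| + 2 * \sum_v vgenus G v == 2 * g + 2 * #|V| + #|legs G|)%N.
Proof.
have := card_halfedges G; rewrite /genus /h1.
move: (\sum_v vgenus G v)%N #|edges G| #|V| #|H| #|legs G| => S E K M L.
by move=> ME; apply/eqP/eqP; lia.
Qed.

Lemma sum_stability (V H : finType) (G : graph_on V H) :
  (\sum_v (2 * vgenus G v + valence G v) = 2 * \sum_v vgenus G v + #|H|)%N.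
Proof. by rewrite big_split /= -big_distrr /= sum_valence. Qed.

Lemma isolated_vertex (V H : finType) (G : graph_on V H) (v : V) :
  gconnected G ->
  (forall h, vertex_of G h = v -> vertex_of G (flip G h) = v) ->
  forall u, u = v.
Proof.
case/andP=> _ /forallP/(_ v)/forallP conn vv u.
have /connectP[p pP ->] := conn u.
suff: forall w, w = v -> path (adjacent G) w p -> last w p = v by apply.
elim: p {pP} => //= w' p IH w wv.
case/andP=> /existsP[h /andP[/eqP h1 /eqP h2]]; apply: IH.
by rewrite -h2 vv // h1.
Qed.

Section Isomorphism.
Variables (V H V' H' : finType) (G : graph_on V H) (G' : graph_on V' H').
Variables (f : V -> V') (k : H -> H').
Hypothesis (bf : bijective f) (bk : bijective k).
Hypothesis (vk : forall h, vertex_of G' (k h) = f (vertex_of G h)).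
Hypothesis (ok : forall h, flip G' (k h) = k (flip G h)).
Hypothesis (gf : forall v, vgenus G' (f v) = vgenus G v).

Lemma iso_valence v : valence G' (f v) = valence G v.
Proof.
rewrite /valence -(on_card_preimset (f := k)); last exact: onW_bij.
by apply: eq_card => h; rewrite !inE vk (inj_eq (bij_inj bf)).
Qed.

Lemma iso_legs : #|legs G'| = #|legs G|.
Proof.
rewrite -(on_card_preimset (f := k)); last exact: onW_bij.
by apply: eq_card => h; rewrite !inE ok (inj_eq (bij_inj bk)).
Qed.

Lemma iso_gconnected : gconnected G -> gconnected G'.
Proof.
case: bf => f' fK f'K.
case/andP=> /card_gt0P[v0 _] /forallP conn; apply/andP; split.
  by apply/card_gt0P; exists (f v0).
apply/forallP => u; apply/forallP => w; rewrite -(f'K u) -(f'K w).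
apply: (connect_homo _ (forallP (conn (f' u)) (f' w))) => a b.
case/existsP=> h /andP[/eqP <- /eqP <-]; apply: connect1.
by apply/existsP; exists (k h); rewrite ok !vk !eqxx.
Qed.

Lemma iso_vweight : vweight G' = vweight G.
Proof.
rewrite /vweight (reindex f) /=; last exact: onW_bij.
by apply: eq_bigr => v _; rewrite gf iso_valence.
Qed.

Lemma iso_stable_graph g n : stable_graph g n G -> stable_graph g n G'.
Proof.
case/and4P=> /iso_gconnected cG /forallP sG; rewrite genusE => gG nG.
apply/and4P; split=> //; last by rewrite iso_legs.
  apply/forallP => v; case: bf => f' fK f'K.
  by rewrite -(f'K v) gf iso_valence.
rewrite genusE iso_legs -(bij_eq_card bf) -(bij_eq_card bk).
rewrite (reindex f) /=; last exact: onW_bij.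
by under eq_bigr do rewrite gf.
Qed.

End Isomorphism.

(** * Labelled graphs of bounded vertex genus *)

Section BoundedGraphs.
Variable N : nat.

Section Basics.
Variables V H : finType.

(** Vertex genera are bounded by N so that graphs form a finite type; in type
    (g, n) every N >= 3g + n will do. *)
Definition bdata : finType :=
  ({ffun H -> V} * {ffun H -> H} * {ffun V -> 'I_N.+1})%type.
Definition graph_bdata (d : bdata) :=
  (d.1, [ffun v => d.2 v : nat]).
Definition bgraph : Type := {d : bdata | flip_involutive (graph_bdata d)}.
HB.instance Definition _ := Finite.on bgraph.
Definition graph_of (x : bgraph) : graph_on V H := GraphOn (valP x).
Coercion graph_of : bgraph >-> graph_on.
Definition bgenus (x : bgraph) (v : V) : 'I_N.+1 := (val x).2 v.

Lemma vgenusE (x : bgraph) v : vgenus x v = bgenus x v.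
Proof. by rewrite /vgenus ffunE. Qed.

Lemma bgraphP (x y : bgraph) :
  vertex_of x =1 vertex_of y -> flip x =1 flip y -> bgenus x =1 bgenus y ->
  x = y.
Proof.
move=> exy fxy gxy; apply: val_inj.
rewrite [val x]surjective_pairing [val y]surjective_pairing.
rewrite [(val x).1]surjective_pairing [(val y).1]surjective_pairing.
by congr (_, _, _); apply/ffunP.
Qed.

Variables (r : H -> V) (o : H -> H) (c : V -> 'I_N.+1).
Hypothesis oK : involutive o.

Fact mk_bgraph_subproof :
  flip_involutive
    (graph_bdata ([ffun h => r h], [ffun h => o h], [ffun v => c v])).
Proof. by apply/forallP => h; rewrite !ffunE oK. Qed.

Definition mk_bgraph : bgraph := exist _ (_, _, _) mk_bgraph_subproof.

Lemma vertex_of_mk h : vertex_of mk_bgraph h = r h.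
Proof. by rewrite /vertex_of /= ffunE. Qed.
Lemma flip_mk h : flip mk_bgraph h = o h.
Proof. by rewrite /flip /= ffunE. Qed.
Lemma bgenus_mk v : bgenus mk_bgraph v = c v.
Proof. by rewrite /bgenus /= ffunE. Qed.
End Basics.

Definition mkE := (vertex_of_mk, flip_mk, bgenus_mk, vgenusE).

Section Relabel.
Variables V H V' H' : finType.
Variables (f : V -> V') (f' : V' -> V) (k : H -> H') (k' : H' -> H).
Hypothesis (fK : cancel f f') (f'K : cancel f' f).
Hypothesis (kK : cancel k k') (k'K : cancel k' k).

Fact relabel_subproof (x : bgraph V H) :
  involutive (fun h => k (flip x (k' h))).
Proof. by move=> h; rewrite kK flipK k'K. Qed.

Definition relabel (x : bgraph V H) : bgraph V' H' :=
  mk_bgraph (fun h => f (vertex_of x (k' h))) (fun v => bgenus x (f' v))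
    (relabel_subproof x).

Lemma vertex_of_relabel x h : vertex_of (relabel x) (k h) = f (vertex_of x h).
Proof. by rewrite mkE kK. Qed.
Lemma flip_relabel x h : flip (relabel x) (k h) = k (flip x h).
Proof. by rewrite mkE kK. Qed.
Lemma bgenus_relabel x v : bgenus (relabel x) (f v) = bgenus x v.
Proof. by rewrite mkE fK. Qed.
Lemma vgenus_relabel x v : vgenus (relabel x) (f v) = vgenus x v.
Proof. by rewrite !vgenusE bgenus_relabel. Qed.
End Relabel.

Section RelabelTheory.
Variables V H V' H' : finType.
Variables (f : V -> V') (f' : V' -> V) (k : H -> H') (k' : H' -> H).
Hypothesis (fK : cancel f f') (f'K : cancel f' f).
Hypothesis (kK : cancel k k') (k'K : cancel k' k).
Let bf : bijective f := Bijective fK f'K.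
Let bf' : bijective f' := Bijective f'K fK.
Let bk : bijective k := Bijective kK k'K.
Let bk' : bijective k' := Bijective k'K kK.
Notation rel := (relabel f f' kK k'K).

Lemma relabelK : cancel (relabel f f' kK k'K) (relabel f' f k'K kK).
Proof.
by move=> x; apply: bgraphP => a; rewrite !mkE ?kK ?fK.
Qed.

Lemma stable_graph_relabel g n x :
  stable_graph g n (rel x) = stable_graph g n x.
Proof.
apply/idP/idP; last first.
  exact: (iso_stable_graph bf bk (vertex_of_relabel _ _ _ _ _)
            (flip_relabel _ _ _ _ _) (vgenus_relabel fK _ _ _)).
rewrite -{2}(relabelK x).
exact: (iso_stable_graph bf' bk' (vertex_of_relabel _ _ _ _ _)
            (flip_relabel _ _ _ _ _) (vgenus_relabel f'K _ _ _)).
Qed.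

Lemma valence_relabel x v : valence (rel x) (f v) = valence x v.
Proof. exact: (iso_valence bf bk (vertex_of_relabel _ _ _ _ _)). Qed.

Lemma vweight_relabel x : vweight (rel x) = vweight x.
Proof.
exact: (iso_vweight bf bk (vertex_of_relabel _ _ _ _ _)
          (vgenus_relabel fK _ _ _)).
Qed.
End RelabelTheory.

Lemma relabel_bij (V H V' H' : finType) (f : V -> V') f' (k : H -> H') k'
    (fK : cancel f f') (f'K : cancel f' f)
    (kK : cancel k k') (k'K : cancel k' k) :
  bijective (relabel f f' kK k'K).
Proof.
exists (relabel f' f k'K kK); first exact: relabelK fK _ _.
exact: relabelK f'K _ _.
Qed.

Definition stable_sum (g n : nat) (V H : finType) : rat :=
  \sum_(x : bgraph V H | stable_graph g n x) vweight x.

Lemma stable_sum_card g n (V H V' H' : finType) :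
  #|V| = #|V'| -> #|H| = #|H'| -> stable_sum g n V H = stable_sum g n V' H'.
Proof.
have bijE (A B : finType) : #|A| = #|B| ->
    exists (f : A -> B) (f' : B -> A), cancel f f' /\ cancel f' f.
  move=> AB; exists (fun a => enum_val (cast_ord AB (enum_rank a))).
  exists (fun b => enum_val (cast_ord (esym AB) (enum_rank b))).
  by split=> a; rewrite enum_valK ?cast_ordK ?cast_ordKV enum_rankK.
move=> /bijE[f [f' [fK f'K]]] /bijE[k [k' [kK k'K]]].
rewrite /stable_sum [RHS](reindex (relabel f f' kK k'K)) /=; last first.
  exact/onW_bij/relabel_bij.
apply: eq_big => x => [|_]; last by rewrite vweight_relabel.
by rewrite stable_graph_relabel.
Qed.

(** A sum over graphs with a mark p, such as a vertex or a tuple of half-edges,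
    is a multiple of the sum with one fixed mark p0, as soon as some relabelling
    takes p to p0. *)
Lemma sum_marked (V H X : finType) (A : {pred X}) (p0 : X)
    (Q : bgraph V H -> X -> rat) :
  (forall p, p \in A -> exists (s : {perm V}) (t : {perm H}),
     forall x, Q (relabel s (s^-1)%g (permK t) (permKV t) x) p0 = Q x p) ->
  \sum_(p in A) \sum_x Q x p = #|A|%:R * \sum_x Q x p0.
Proof.
move=> mv; rewrite -sum1_card natr_sum mulr_suml.
apply: eq_bigr => p /mv[s [t E]].
rewrite mul1r [RHS](reindex (relabel s (s^-1)%g (permK t) (permKV t))) /=.
  by apply: eq_bigr => x _; rewrite E.
exact/onW_bij/(relabel_bij (permK s) (permKV s)).
Qed.

End BoundedGraphs.

(** * Attaching a leg to a vertex *)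

Lemma card_option_set (T : finType) (P : pred (option T)) :
  #|[set h | P h]| = (P None + #|[set h | P (Some h)]|)%N.
Proof.
have sI : injective (@Some T) by move=> ? ? [].
rewrite (cardsD1 None) inE -(card_imset [set h | P (Some h)] sI).
congr (_ + _)%N; apply: eq_card => -[h|]; rewrite !inE /=.
  by rewrite mem_imset ?inE.
by apply/esym/imsetP => -[].
Qed.

Lemma big_option (R : Type) (idx : R) (op : Monoid.com_law idx) (T : finType)
    (F : option T -> R) :
  \big[op/idx]_(x : option T) F x = op (F None) (\big[op/idx]_x F (Some x)).
Proof.
rewrite (bigD1 None) //=; congr (op _ _).
rewrite (reindex_omap (some : T -> option T) id) /=; last by case.
by apply: eq_bigl => x; rewrite eqxx.
Qed.

Lemma big_bij (R : Type) (idx : R) (op : Monoid.com_law idx) (I J : finType)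
    (P : pred I) (Q : pred J) (h : J -> I) (F : I -> R) :
  (forall j, Q j -> P (h j)) -> {in Q &, injective h} ->
  (forall x, P x -> exists2 j, Q j & x = h j) ->
  \big[op/idx]_(x | P x) F x = \big[op/idx]_(j | Q j) F (h j).
Proof.
move=> QP hI PQ; rewrite -(big_imset (A := Q) F hI) /=; apply: eq_bigl => x.
by apply/idP/imsetP => [/PQ[j jQ ->]|[j jQ ->]]; [exists j|exact: QP].
Qed.

Lemma chiMS g n : (2 < 2 * g + n)%N ->
  chiM g n.+1 = (2 - (2 * g + n)%:R) * chiM g n.
Proof.
move=> gn; rewrite /chiM exprS.
have -> : (2 * g + n.+1 - 3 = (2 * g + n - 3).+1)%N by lia.
rewrite factS natrM.
have -> : (2 * g + n - 3).+1%:R = (2 * g + n)%:R - 2 :> rat.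
  by rewrite -natrB; [congr (_%:R); lia|lia].
ring.
Qed.

(** The vertices that become unstable when they lose a half-edge, that is
    those of type (0,3) and (1,1). *)
Definition critical (V H : finType) (G : graph_on V H) (v : V) : bool :=
  (2 * vgenus G v + valence G v == 3)%N.

Section AddLeg.
Variables (N : nat) (V H : finType).

Definition add_leg_vertex (y : bgraph N V H) (v : V) (h : option H) : V :=
  if h is Some h' then vertex_of y h' else v.

Fact add_leg_subproof (y : bgraph N V H) : involutive (omap (flip y)).
Proof. by case=> //= h; rewrite flipK. Qed.

Definition add_leg (y : bgraph N V H) (v : V) : bgraph N V (option H) :=
  mk_bgraph (add_leg_vertex y v) (bgenus y) (add_leg_subproof y).

Variables (y : bgraph N V H) (v : V).

Lemma vgenus_add_leg u : vgenus (add_leg y v) u = vgenus y u.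
Proof. by rewrite !mkE. Qed.

Lemma valence_add_leg u : valence (add_leg y v) u = ((u == v) + valence y u)%N.
Proof.
rewrite /valence card_option_set mkE /= eq_sym; congr (_ + _)%N.
by apply: eq_card => h; rewrite !inE mkE.
Qed.

Lemma legs_add_leg : #|legs (add_leg y v)| = #|legs y|.+1.
Proof.
rewrite card_option_set mkE /=; congr _.+1.
by apply: eq_card => h; rewrite !inE mkE.
Qed.

Lemma gconnected_add_leg : gconnected (add_leg y v) = gconnected y.
Proof.
congr (_ && _); apply: eq_forallb => a; apply: eq_forallb => b.
apply/idP/idP; apply: (connect_homo (f := id)) => {}a {}b.
  case/existsP=> -[h|]; rewrite !mkE /= => /andP[/eqP <- /eqP <-] //.
  by apply/connect1/existsP; exists h; rewrite !eqxx.
case/existsP=> h /andP[/eqP <- /eqP <-]; apply/connect1/existsP.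
by exists (Some h); rewrite !mkE !eqxx.
Qed.

(** Criticality is measured with the leg attached: v was stable before exactly
    when it is stable and not critical afterwards. *)
Lemma stable_graph_add_leg g n :
  stable_graph g n.+1 (add_leg y v) && ~~ critical (add_leg y v) v
  = stable_graph g n y.
Proof.
have -> : stable_graph g n y = [&& gconnected y, gstable (add_leg y v)
    && ~~ critical (add_leg y v) v, genus y == g%:Z & #|legs y| == n].
  congr [&& _, _ & _]; rewrite /critical.
  apply/forallP/andP => [st|[/forallP st cv] u].
    split; last first.
      by have := st v; rewrite vgenus_add_leg valence_add_leg eqxx; lia.
    apply/forallP => u; have := st u.
    by rewrite vgenus_add_leg valence_add_leg; lia.
  have := st u; move: cv; rewrite !vgenus_add_leg !valence_add_leg eqxx.
  by case: (eqVneq u v) => [->|_]; lia.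
rewrite /stable_graph !genusE gconnected_add_leg legs_add_leg eqSS card_option.
under eq_bigr do rewrite vgenus_add_leg.
rewrite (_ : (2 + #|H|.+1 + _ == _)%N = (2 + #|H| + 2 * \sum_u vgenus y u
  == 2 * g + 2 * #|V| + #|legs y|)%N); last by apply/eqP/eqP; lia.
by rewrite -!andbA; do 3!congr (_ && _); rewrite andbA andbC.
Qed.

Lemma vweight_add_leg : gstable y ->
  vweight (add_leg y v) = (2 - (2 * vgenus y v + valence y v)%:R) * vweight y.
Proof.
move/forallP/(_ v) => st; rewrite /vweight (bigD1 v) //= [in RHS](bigD1 v) //=.
rewrite vgenus_add_leg valence_add_leg eqxx add1n chiMS // -mulrA.
congr (_ * (_ * _)); apply: eq_bigr => u /negbTE uv.
by rewrite vgenus_add_leg valence_add_leg uv.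
Qed.
End AddLeg.

(** Attaching a leg to the vertex v multiplies the weight by the Euler
    characteristic 2 - 2g_v - val_v, and these add up to 2 - 2g - n. *)
Lemma sum_add_leg N (V H : finType) g n :
  \sum_(x : bgraph N V (option H) |
      [&& stable_graph g n.+1 x, flip x None == None
        & ~~ critical x (vertex_of x None)]) vweight x
  = (2 - (2 * g + n)%:R) * stable_sum N g n V H.
Proof.
pose Q (p : bgraph N V H * V) := stable_graph g n p.1.
pose h (p : bgraph N V H * V) := add_leg p.1 p.2.
have surj (x : bgraph N V (option H)) :
    [&& stable_graph g n.+1 x, flip x None == None
      & ~~ critical x (vertex_of x None)] -> exists2 p, Q p & x = h p.
  case/and3P=> sx /eqP xl nc.
  pose o z := odflt z (flip x (Some z)).
  have oE z : flip x (Some z) = Some (o z).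
    rewrite /o; case E: (flip x (Some z)) => [z'|] //=.
    by move: (flipK x (Some z)); rewrite E xl.
  have oK : involutive o by move=> z; apply: Some_inj; rewrite -!oE flipK.
  pose y := mk_bgraph (fun z => vertex_of x (Some z)) (bgenus x) oK.
  have xE : x = add_leg y (vertex_of x None).
    by apply: bgraphP => [[z|]|[z|]|v]; rewrite !mkE //= !mkE ?oE.
  exists (y, vertex_of x None) => //; rewrite /Q /=.
  by rewrite -(stable_graph_add_leg y (vertex_of x None)) -xE sx.
rewrite (@big_bij _ _ _ _ _ _ Q h).
- transitivity (\sum_(y : bgraph N V H | stable_graph g n y)
      \sum_v vweight (add_leg y v)).
    by rewrite pair_big; apply: eq_bigl => p; rewrite andbT.
  rewrite mulr_sumr.
  apply: eq_bigr => y sy; have /and4P[_ st gy /eqP ny] := sy.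
  under eq_bigr do rewrite vweight_add_leg //.
  rewrite -mulr_suml; congr (_ * _).
  rewrite sumrB -!natr_sum sum_stability sum_nat_const.
  move: gy; rewrite genusE ny => /eqP/(congr1 (fun k => k%:R : rat)).
  rewrite !natrD !natrM; lra.
- by move=> [y v]; rewrite /Q /h /= -(stable_graph_add_leg y v) !mkE.
- move=> [y v] [y' v'] _ _; rewrite /h /= => E.
  have Ev z := congr1 (fun x : bgraph _ _ _ => vertex_of x z) E.
  have Eo z := congr1 (fun x : bgraph _ _ _ => flip x z) E.
  have Eg u := congr1 (fun x : bgraph _ _ _ => bgenus x u) E.
  congr (_, _); last by have := Ev None; rewrite !mkE.
  apply: bgraphP => [z|z|u].
  + by have := Ev (Some z); rewrite !mkE.
  + by have := Eo (Some z); rewrite !mkE => -[].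
  + by have := Eg u; rewrite !mkE.
- exact: surj.
Qed.

(** * Attaching a leg to an edge *)

(** A closed critical vertex would be the only one, and 2g - 2 + (n + 1) would
    be 1, whereas 2g - 2 + n > 0. *)
Lemma critical_not_closed (V H : finType) (G : graph_on V H) g n v :
  (2 < 2 * g + n)%N -> stable_graph g n.+1 G -> critical G v ->
  ~ (forall h, vertex_of G h = v -> vertex_of G (flip G h) = v).
Proof.
move=> gn /and4P[cG _]; rewrite genusE => /[swap] /eqP -> /eqP gG /eqP cv.
move/(isolated_vertex cG) => uv.
have V1 (F : V -> nat) : (\sum_u F u = F v)%N.
  by rewrite (bigD1 v) //= big1 ?addn0 // => u; rewrite (uv u) eqxx.
have := sum_stability G; rewrite V1 cv => Hv.
have := V1 (fun _ => 1%N); rewrite sum1_card => cV.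
by move: gG; rewrite cV; lia.
Qed.

(** Here l is the leg to be forgotten.  When l, a and b are distinct, they are
    all the half-edges at v, and v has genus 0. *)
Definition tripod (V H : finType) (g n : nat) (G : graph_on V H)
    (v : V) (l a b : H) : bool :=
  [&& stable_graph g n G, flip G l == l, vertex_of G l == v,
      vertex_of G a == v, vertex_of G b == v & critical G v].

Lemma tripod_relabel N (V H : finType) (s : {perm V}) (t : {perm H}) g n
    (x : bgraph N V H) v l a b :
  tripod g n (relabel s (s^-1)%g (permK t) (permKV t) x) (s v) (t l) (t a) (t b)
  = tripod g n x v l a b.
Proof.
rewrite /tripod (stable_graph_relabel (permK s) (permKV s)) flip_relabel.
rewrite !vertex_of_relabel !(inj_eq perm_inj) /critical.
rewrite vgenus_relabel; last exact: permK.
by rewrite (valence_relabel (permK s) (permKV s)).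
Qed.

Notation att_l := None (only parsing).
Notation att_a := (Some None) (only parsing).
Notation att_b := (Some (Some None)) (only parsing).
Notation old z := (Some (Some (Some z))) (only parsing).

Lemma chiM03 : chiM 0 3 = 1.
Proof.
have := bernoulliE 0; rewrite big_ord1 /= bin0 mul1r /chiM => ->.
by rewrite fact0; vm_compute.
Qed.

Section Insert.
Variables (N : nat) (V H : finType).

Definition insert_vertex (y : bgraph N V H) (e : option (option (option H))) :=
  if e is old z then Some (vertex_of y z) else None.

(** The half-edge a is joined to h, and b to the former partner of h; when h is
    a leg, b takes over as the leg. *)
Definition insert_flip (y : bgraph N V H) (h : H)
    (e : option (option (option H))) :=
  match e with
  | att_l => att_l
  | att_a => old h
  | att_b => if flip y h == h then att_b else old (flip y h)
  | old z => if z == h then att_a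
             else if z == flip y h then att_b else old (flip y z)
  end.

Fact insert_subproof y h : involutive (insert_flip y h).
Proof.
have fI := inj_eq (can_inj (flipK y)).
case=> [[[z|]|]|] //=.
- case: (eqVneq z h) => [->//|zh]; case: (eqVneq z (flip y h)) => [E|zf] /=.
    by rewrite -E (negbTE zh).
  by rewrite fI (negbTE zh) flipK -[h in _ == h](flipK y) fI (negbTE zf).
- by case E: (flip y h == h) => /=; rewrite ?E ?eqxx.
- by rewrite eqxx.
Qed.

Definition insert (y : bgraph N V H) (h : H) :
    bgraph N (option V) (option (option (option H))) :=
  mk_bgraph (insert_vertex y)
    (fun v => if v is Some u then bgenus y u else ord0)
    (insert_subproof y h).

Variables (y : bgraph N V H) (h : H).
Notation x := (insert y h).

Lemma vgenus_insert u : vgenus x (Some u) = vgenus y u.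
Proof. by rewrite !mkE. Qed.
Lemma vgenus_insert_None : vgenus x None = 0%N.
Proof. by rewrite !mkE. Qed.

Lemma valence_insert u : valence x (Some u) = valence y u.
Proof.
rewrite /valence !card_option_set !mkE /= !add0n.
by apply: eq_card => z; rewrite !inE mkE.
Qed.

Lemma valence_insert_None : valence x None = 3%N.
Proof.
rewrite /valence !card_option_set !mkE /= eq_card0 // => z.
by rewrite !inE mkE /=.
Qed.

Lemma legs_insert : #|legs x| = #|legs y|.+1.
Proof.
rewrite /legs !card_option_set !mkE /= add0n add1n; congr _.+1.
rewrite [RHS](cardsD1 h) inE; congr (_ + _)%N; first by case: (flip y h == h).
apply: eq_card => z; rewrite !inE mkE /=.
case: (eqVneq z h) => //= zh; case: (eqVneq z (flip y h)) => //= zE.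
by have -> : flip y z = h; [rewrite zE flipK|rewrite [RHS]eq_sym (negbTE zh)].
Qed.

Lemma gconnected_insert : gconnected x = gconnected y.
Proof.
rewrite /gconnected card_option /=.
have V0 : (0 < #|V|)%N by apply/card_gt0P; exists (vertex_of y h).
rewrite V0 /=.
have adj e : adjacent x (vertex_of x e) (vertex_of x (flip x e)).
  by apply/existsP; exists e; rewrite !eqxx.
apply/forallP/forallP => conn u; apply/forallP.
  pose f v := if v is Some v' then v' else vertex_of y h.
  move=> v; apply: (connect_homo (f := f) _ (forallP (conn (Some u)) (Some v))).
  move=> a b /existsP[e /andP[/eqP <- /eqP <-]] {a b}.
  have adjy z : adjacent y (vertex_of y z) (vertex_of y (flip y z)).
    by apply/existsP; exists z; rewrite !eqxx.
  case: e => [[[z|]|]|]; rewrite !mkE //=.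
    case: (eqVneq z h) => [->//|zh]; case: (eqVneq z (flip y h)) => [->|zf] /=.
      by rewrite -{2}(flipK y h); exact/connect1/adjy.
    exact/connect1/adjy.
  by case: ifP => //= _; exact/connect1/adjy.
have hN : connect (adjacent x) (Some (vertex_of y h)) None.
  by have /connect1 := adj (old h); rewrite !mkE /= eqxx.
have Nf : connect (adjacent x) None (Some (vertex_of y (flip y h))).
  have := adj att_b; rewrite !mkE /=; case: eqP => [-> _|_ /connect1 //].
  by have /connect1 := adj att_a; rewrite !mkE.
have Nh : connect (adjacent x) None (Some (vertex_of y h)).
  by have /connect1 := adj att_a; rewrite !mkE.
have fN : connect (adjacent x) (Some (vertex_of y (flip y h))) None.
  case: (eqVneq (flip y h) h) => [-> //|fh].
  by have /connect1 := adj (old (flip y h)); rewrite !mkE /= (negbTE fh) eqxx.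
have cS a b : connect (adjacent x) (Some a) (Some b).
  apply: (connect_homo (f := some) _ (forallP (conn a) b)) => {}a {}b.
  case/existsP=> z /andP[/eqP <- /eqP <-].
  case: (eqVneq z h) => [->|zh]; first exact: connect_trans hN Nf.
  case: (eqVneq z (flip y h)) => [->|zf].
    by rewrite flipK; apply: connect_trans fN Nh.
  have /connect1 := adj (old z).
  by rewrite !mkE /= (negbTE zh) (negbTE zf).
move=> v; case: u => [u|]; case: v => [v|] //.
  exact: connect_trans (cS _ _) hN.
exact: connect_trans Nh (cS _ _).
Qed.

Lemma stable_graph_insert g n : stable_graph g n.+1 x = stable_graph g n y.
Proof.
rewrite /stable_graph gconnected_insert !genusE legs_insert !card_option eqSS.
rewrite big_option /= vgenus_insert_None.
under eq_bigr do rewrite vgenus_insert.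
congr [&& _, _, _ & _].
  apply/forallP/forallP => st u.
    by have := st (Some u); rewrite vgenus_insert valence_insert.
  case: u => [u|]; first by rewrite vgenus_insert valence_insert.
  by rewrite vgenus_insert_None valence_insert_None.
by apply/eqP/eqP; lia.
Qed.

Lemma vweight_insert : vweight x = vweight y.
Proof.
rewrite /vweight big_option /= vgenus_insert_None valence_insert_None.
rewrite chiM03 mul1r.
by apply: eq_bigr => u _; rewrite vgenus_insert valence_insert.
Qed.

Lemma tripod_insert g n :
  tripod g n.+1 x None att_l att_a att_b = stable_graph g n y.
Proof.
rewrite /tripod stable_graph_insert /critical valence_insert_None.
by rewrite vgenus_insert_None !mkE /= andbT.
Qed.
End Insert.

Section Tripods.
Variables (N : nat) (V H : finType) (g n : nat).
Hypothesis gn : (2 < 2 * g + n)%N.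
Notation H3 := (option (option (option H))).
Notation tri x := (tripod g n.+1 x None att_l att_a att_b).

Lemma tripod_old (x : bgraph N (option V) H3) : tri x ->
  vgenus x None = 0%N /\ forall z, vertex_of x (old z) != None.
Proof.
case/and5P=> _ _ vl va /andP[vb].
rewrite /critical /valence !card_option_set vl va vb /=.
set k := #|_| => /eqP c; have k0 : k = 0%N by lia.
split; first by lia.
move/eqP: k0; rewrite cards_eq0 => /eqP/setP E z.
by have := E z; rewrite !inE => ->.
Qed.

(** Otherwise the vertex of the leg would be closed. *)
Lemma tripod_open (x : bgraph N (option V) H3) : tri x ->
  ~ (flip x att_a = att_a /\ flip x att_b = att_b) /\ flip x att_a <> att_b.
Proof.
move=> tx; have [_ vold] := tripod_old tx.
have /and5P[sx ll vl va /andP[vb c]] := tx.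
have closed : vertex_of x (flip x att_a) = None ->
    vertex_of x (flip x att_b) = None -> False.
  move=> ca cb; apply: (critical_not_closed gn sx c) => -[[[z|]|]|] //.
    by move/eqP; rewrite (negbTE (vold z)).
  by rewrite (eqP ll).
split=> [[ea eb]|eab]; apply: closed; rewrite ?ea ?eb ?eab; apply/eqP => //.
by rewrite -eab flipK.
Qed.

Lemma insert_inj (y y' : bgraph N V H) h h' :
  insert y h = insert y' h' -> y = y' /\ h = h'.
Proof.
move=> E.
have Ev z := congr1 (fun x : bgraph _ _ _ => vertex_of x z) E.
have Eo z := congr1 (fun x : bgraph _ _ _ => flip x z) E.
have Eg u := congr1 (fun x : bgraph _ _ _ => bgenus x u) E.
have hh : h = h' by have := Eo att_a; rewrite !mkE => -[].
rewrite -hh in Eo *; split=> //.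
have fh : flip y h = flip y' h.
  have := Eo att_b; rewrite !mkE /=.
  by do 2!case: eqP => [->|_] //; move=> [].
apply: bgraphP => [z|z|u].
- by have := Ev (old z); rewrite !mkE => -[].
- case: (eqVneq z h) => [->//|zh]; case: (eqVneq z (flip y h)) => [->|zf].
    by rewrite {2}fh !flipK.
  by have := Eo (old z); rewrite !mkE /= -fh (negbTE zh) (negbTE zf) => -[].
- by have := Eg (Some u); rewrite !mkE.
Qed.

(** The half-edge h to which a is attached is where the leg goes: into the edge
    of h if h is internal, and onto the external edge h otherwise. *)
Lemma sum_insert (F : bgraph N (option V) H3 -> rat) :
  \sum_(x : bgraph N (option V) H3 | tri x && (flip x att_a != att_a)) F x
  = \sum_(y : bgraph N V H | stable_graph g n y) \sum_h F (insert y h).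
Proof.
pose Q (p : bgraph N V H * H) := stable_graph g n p.1.
pose ins (p : bgraph N V H * H) := insert p.1 p.2.
transitivity (\sum_(p | Q p) F (ins p)); last first.
  by rewrite pair_big; apply: eq_bigl => p; rewrite andbT.
have surj (x : bgraph N (option V) H3) : tri x && (flip x att_a != att_a) ->
    exists2 p, Q p & x = ins p.
  case/andP=> tx na; have [x0 vold] := tripod_old tx.
  have [_ nab] := tripod_open tx.
  have /and5P[sx /eqP ll /eqP vl /eqP va /andP[/eqP vb c]] := tx.
  have fI := can_inj (flipK x).
  have [h ah] : exists h, flip x att_a = old h.
    case E: (flip x att_a) na nab => [[[h|]|]|] //; first by exists h.
    by have := fI _ _ (etrans E (esym ll)).
  have ha : flip x (old h) = att_a by rewrite -ah flipK.
  have bl : flip x att_b <> att_l.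
    by move=> E; have := fI _ _ (etrans E (esym ll)).
  have ba : flip x att_b <> att_a.
    by move=> E; have := fI _ _ (etrans E (esym ha)).
  (* The smaller graph joins the two half-edges that were attached to a and b,
     or makes h a leg if b is one. *)
  pose o z := match flip x (old z) with
    | old w => w
    | att_a => if flip x att_b is old w then w else z
    | att_b => h
    | att_l => z
    end.
  have oh : o h = if flip x att_b is old w then w else h.
    by rewrite /o ha; case: (flip x att_b) => [[[]|]|].
  have oK : involutive o.
    move=> z; rewrite {2}/o; case E: (flip x (old z)) => [[[w|]|]|].
    - by rewrite /o -E flipK.
    - by have := flipK x (old z); rewrite E oh => ->.
    - have zh : z = h by have := flipK x (old z); rewrite E ah => -[].
      rewrite zh; case Eb: (flip x att_b) => [[[w|]|]|]; rewrite ?oh ?Eb //.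
      by rewrite /o -Eb flipK.
    - by have := fI _ _ (etrans E (esym ll)).
  have vE z : exists v, vertex_of x (old z) == Some v.
    by have := vold z; case: (vertex_of x (old z)) => // v; exists v.
  pose y := mk_bgraph (fun z => xchoose (vE z)) (fun v => bgenus x (Some v)) oK.
  have xE : x = insert y h.
    apply: bgraphP => [[[[z|]|]|]|[[[z|]|]|]|[v|]]; rewrite !mkE //=.
    - by rewrite mkE; apply/eqP/(xchooseP (vE z)).
    - rewrite mkE; case: (eqVneq z h) => [->//|zh].
      rewrite mkE oh; case E: (flip x (old z)) => [[[w|]|]|].
      + case Eb: (flip x att_b) => [[[w'|]|]|]; rewrite ?(negbTE zh) /o ?E //.
        by case: eqP => // zw; have := flipK x att_b; rewrite Eb -zw E.
      + by have := flipK x (old z); rewrite E => ->; rewrite eqxx.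
      + have := flipK x (old z); rewrite E ah => -[] /eqP.
        by rewrite eq_sym (negbTE zh).
      + by have := fI _ _ (etrans E (esym ll)).
    - rewrite mkE oh; case Eb: (flip x att_b) => [[[w|]|]|]; rewrite ?eqxx //.
      case: eqP => // wh; have := flipK x att_b; by rewrite Eb wh ha.
    - by apply: val_inj; rewrite /= -vgenusE x0.
  exists (y, h) => //; rewrite /Q /=.
  by rewrite -(tripod_insert y h) -xE.
apply: big_bij => [[y h]|[y h] [y' h'] _ _|]; last exact: surj.
  by rewrite /Q /ins /= tripod_insert !mkE andbT.
by move/insert_inj=> [] /= -> ->.
Qed.
End Tripods.

Section SumTripods.
Variables (N : nat) (V H : finType) (g n : nat).
Hypothesis gn : (2 < 2 * g + n)%N.
Notation H3 := (option (option (option H))).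
Notation tri x := (tripod g n.+1 x None att_l att_a att_b).

(** The graphs in which a is not a leg contribute |H| by [sum_insert].  Those in
    which a is a leg become, after exchanging a and b, the inserted graphs in
    which b is a leg, that is those with h a leg; they contribute n. *)
Lemma sum_tripod :
  \sum_(x : bgraph N (option V) H3 | tri x) vweight x
  = (#|H| + n)%:R * stable_sum N g n V H.
Proof.
rewrite (bigID (fun x : bgraph N (option V) H3 => flip x att_a != att_a)) /=.
rewrite natrD mulrDl; congr (_ + _).
  rewrite sum_insert // mulr_sumr; apply: eq_bigr => y _.
  by under eq_bigr do rewrite vweight_insert; rewrite sumr_const mulr_natl.
pose s : {perm option V} := 1%g.
pose t : {perm H3} := tperm att_a att_b.
have tP (x : bgraph N (option V) H3) :
    tri (relabel s (s^-1)%g (permK t) (permKV t) x) = tri x.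
  rewrite -[RHS](tripod_relabel s t) perm1 tpermL tpermR tpermD //.
  by rewrite /tripod; do 3!congr (_ && _); rewrite andbCA.
rewrite (reindex (relabel s (s^-1)%g (permK t) (permKV t))) /=; last first.
  exact/onW_bij/(relabel_bij N (permK s) (permKV s)).
transitivity (\sum_(x : bgraph N (option V) H3 |
    tri x && (flip x att_a != att_a))
    if flip x att_b == att_b then vweight x else 0).
  rewrite -big_mkcondr; apply: eq_big => [x|x _]; last first.
    by rewrite (vweight_relabel (permK s) (permKV s)).
  rewrite tP -andbA; case tx: (tri x) => //=.
  have := @flip_relabel N _ _ _ _ s (s^-1)%g _ _
    (permK t) (permKV t) x att_b.
  rewrite tpermR => ->; rewrite negbK.
  have -> : (t (flip x att_b) == att_a) = (flip x att_b == att_b).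
    by rewrite -(inj_eq (@perm_inj _ t) _ att_b) tpermR.
  have [ab _] := tripod_open gn tx.
  by case: eqP => [eb|//]; case: eqP => // ea; case: ab.
rewrite sum_insert // mulr_sumr; apply: eq_bigr => y /and4P[_ _ _ /eqP <-].
rewrite -big_mkcond /= mulr_natl -sumr_const.
apply: eq_big => [h|h _]; last by rewrite vweight_insert.
by rewrite inE !mkE /=; case: (_ == h).
Qed.
End SumTripods.

Section SumCritical.
Variables (N : nat) (V H : finType) (g n : nat).
Hypothesis gn : (2 < 2 * g + n)%N.

Lemma critical_leg_valence (x : bgraph N V (option H)) :
  stable_graph g n.+1 x -> flip x None == None ->
  critical x (vertex_of x None) ->
  #|[set z | vertex_of x (Some z) == vertex_of x None]| = 2%N.
Proof.
move=> sx /eqP ll c; have := c; rewrite /critical /valence card_option_set eqxx.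
set k := #|_| => /eqP k3; suff: k <> 0%N by lia.
move=> /eqP; rewrite cards_eq0 => /eqP/setP E.
apply: (critical_not_closed gn sx c) => -[z zx|]; last by rewrite ll.
by have := E z; rewrite !inE zx eqxx.
Qed.

(** The other two half-edges at the vertex of the leg can be ordered in two
    ways, whence the factor 2. *)
Lemma sum_critical_tripod :
  2 * \sum_(x : bgraph N V (option H) | [&& stable_graph g n.+1 x,
         flip x None == None & critical x (vertex_of x None)]) vweight x
  = \sum_(p : V * (H * H) | p.2.1 != p.2.2)
      \sum_(x : bgraph N V (option H))
         if tripod g n.+1 x p.1 None (Some p.2.1) (Some p.2.2)
         then vweight x else 0.
Proof.
rewrite exchange_big /= mulr_sumr big_mkcond /=; apply: eq_bigr => x _.
rewrite -big_mkcondr /= sumr_const -[RHS]mulr_natl.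
have [/and3P[sx ll c]|nx] := ifP; last first.
  rewrite eq_card0 ?mulr0 ?mul0r // => -[v [a b]]; apply/negP.
  case/andP=> /= _ /and5P[sx ll /eqP vl _ /andP[_ c]].
  by rewrite sx ll vl c in nx.
congr (_%:R * _).
have /eqP/cards2P[a [b [ab E]]] := critical_leg_valence sx ll c.
set v := vertex_of x None in E c *.
rewrite (@eq_card _ _ (mem [set (v, (a, b)); (v, (b, a))])).
  by rewrite cards2 !xpair_eqE eqxx /= (negbTE ab).
move=> [w [a' b']]; rewrite !inE !xpair_eqE /tripod -/v sx ll /=.
rewrite unfold_in /= [v == w]eq_sym.
case: (eqVneq w v) => [->|_]; last by rewrite andbF.
have /setP E' := E; have := E' a'; have := E' b'; rewrite !inE => -> ->.
rewrite c andbT /=.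
case: (eqVneq a' b') => [->|a'b'] /=.
  by case: (eqVneq b' a) => [->|_]; rewrite /= ?(negbTE ab) ?andbF.
case: (eqVneq a' a) a'b' => [-> /negbTE ab'|_] /=.
  by rewrite eq_sym ab' (negbTE ab) orbF.
case: (eqVneq a' b) => [-> /negbTE bb'|//] /=.
by rewrite [b' == b]eq_sym bb' orbF.
Qed.
End SumCritical.

Lemma card_distinct_pairs (T : finType) :
  #|[pred p : T * T | p.1 != p.2]| = (#|T| * #|T|.-1)%N.
Proof.
rewrite -sum1_card (eq_bigl (fun p : T * T => xpredT p.1 && (p.1 != p.2))) //.
rewrite -(pair_big_dep xpredT (fun p q : T => p != q) (fun _ _ => 1%N)) /=.
rewrite (eq_bigr (fun _ => #|T|.-1)) => [|p _]; first by rewrite sum_nat_const.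
by rewrite sum1_card -(cardC1 p); apply: eq_card => q; rewrite !inE eq_sym.
Qed.

Lemma sum_critical N (V H : finType) g n : (2 < 2 * g + n)%N ->
  2 * \sum_(x : bgraph N (option V) (option (option (option H))) |
         [&& stable_graph g n.+1 x, flip x None == None
           & critical x (vertex_of x None)]) vweight x
  = (#|V|.+1 * (#|H|.+2 * #|H|.+1) * (#|H| + n))%:R * stable_sum N g n V H.
Proof.
move=> gn; rewrite sum_critical_tripod //.
pose A := [pred p : option V * (option (option H) * option (option H))
  | p.2.1 != p.2.2].
rewrite (sum_marked (A := A) (p0 := (None, (None, Some None)))); last first.
  move=> [v [a b]] /= ab.
  pose s : {perm option V} := tperm v None.
  (* The first transposition takes a to its place; b' is where it leaves b. *)
  pose b' := tperm (Some a) (Some None) (Some b).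
  pose t := (tperm (Some a) (Some None) * tperm b' (Some (Some None)))%g.
  have b'E : b' != Some None.
    rewrite -(tpermL (Some a) (Some None)) (inj_eq perm_inj).
    by case: eqP ab => // -[->]; rewrite inE eqxx.
  have b'N : b' != None.
    by rewrite -(@tpermD _ (Some a) (Some None) None) // (inj_eq perm_inj).
  exists s, t => x; rewrite (vweight_relabel (permK s) (permKV s)).
  rewrite -(tripod_relabel s t _ _ x).
  have -> : s v = None by rewrite tpermL.
  have -> : t None = None by rewrite permM !tpermD.
  have -> : t (Some a) = Some None by rewrite permM tpermL tpermD.
  by have -> : t (Some b) = Some (Some None) by rewrite permM -/b' tpermL.
rewrite /= -big_mkcond sum_tripod // mulrA -natrM; congr ((_ * _)%:R * _).
pose B := [pred p : option (option H) * option (option H) | p.1 != p.2].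
rewrite (@eq_card _ _ [predX predT & B]) => [|p]; last by rewrite !inE.
by rewrite cardX card_distinct_pairs !card_option.
Qed.

(** * The recursion for labelled graphs *)

(** Each of the n legs of a graph can be moved to a fixed half-edge by
    relabelling. *)
Lemma sum_legs N (V H : finType) g n :
  n%:R * stable_sum N g n V (option H)
  = (#|H|.+1)%:R * \sum_(x : bgraph N V (option H) |
       stable_graph g n x && (flip x None == None)) vweight x.
Proof.
transitivity (\sum_(l in @predT (option H)) \sum_(x : bgraph N V (option H))
    if stable_graph g n x && (flip x l == l) then vweight x else 0).
  rewrite exchange_big mulr_sumr big_mkcond; apply: eq_bigr => x _ /=.
  case sx: (stable_graph g n (graph_of x)); last by rewrite big1.
  have /and4P[_ _ _ /eqP <-] := sx.
  rewrite -big_mkcondr (eq_bigl (mem (legs (graph_of x)))) => [|l]; last first.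
    by rewrite !inE.
  by rewrite sumr_const mulr_natl.
rewrite (sum_marked (p0 := None)) => [|l _]; last first.
  pose t : {perm option H} := tperm l None.
  exists 1%g, t => x; rewrite (vweight_relabel (permK _) (permKV _)).
  rewrite (stable_graph_relabel (permK _) (permKV _)).
  have <- : t l = None by rewrite tpermL.
  by rewrite flip_relabel (inj_eq perm_inj).
by rewrite -big_mkcond card_option.
Qed.

Lemma stable_sum_leg N (V H : finType) g n :
  n.+1%:R * stable_sum N g n.+1 V (option H)
  = #|H|.+1%:R * ((2 - (2 * g + n)%:R) * stable_sum N g n V H
    + \sum_(x : bgraph N V (option H) | [&& stable_graph g n.+1 x,
         flip x None == None & critical x (vertex_of x None)]) vweight x).
Proof.
rewrite sum_legs -sum_add_leg; congr (_ * _).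
rewrite (bigID (fun x : bgraph N V (option H) =>
  critical x (vertex_of x None))).
by rewrite addrC; congr (_ + _); apply: eq_bigl => x; rewrite -andbA.
Qed.

(** The groupoid cardinality, weighted, of the stable graphs of type (g, n) with
    k vertices and m half-edges. *)
Definition stable_mass N g n (k m : nat) : rat :=
  stable_sum N g n 'I_k 'I_m / (k`! * m`!)%:R.

Lemma stable_massE N g n (V H : finType) :
  stable_sum N g n V H = (#|V|`! * #|H|`!)%:R * stable_mass N g n #|V| #|H|.
Proof.
rewrite /stable_mass mulrC mulfVK; last first.
  by rewrite pnatr_eq0 muln_eq0 negb_or -!lt0n !fact_gt0.
by apply: stable_sum_card; rewrite card_ord.
Qed.

Lemma stable_mass_no_vertex N g n m : stable_mass N g n 0 m = 0.
Proof.
rewrite /stable_mass /stable_sum big1 ?mul0r // => x /andP[/andP[]].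
by rewrite card_ord.
Qed.

(** The recursion of the theorem for graphs of one size.  The graphs that gain a
    trivalent vertex have i = (m - n) / 2 internal edges, so that (m + n) / 2 is
    i + n. *)
Lemma stable_mass_rec N g n k m : (2 < 2 * g + n)%N ->
  n.+1%:R * stable_mass N g n.+1 k.+1 m.+3
  = (2 - (2 * g + n)%:R) * stable_mass N g n k.+1 m.+2
    + (m + n)%:R / 2 * stable_mass N g n k m.
Proof.
move=> gn; have := stable_sum_leg N (option 'I_k) (option (option 'I_m)) g n.
have := sum_critical N 'I_k 'I_m gn.
rewrite !stable_massE !card_option !card_ord.
set s := \sum_(x | _) _ => sE.
have {sE} -> : s = (k.+1 * (m.+2 * m.+1) * (m + n))%:R / 2
    * ((k`! * m`!)%:R * stable_mass N g n k m).
  by apply: (mulfI (x := 2)) => //; rewrite sE; field.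
move=> E; have c0 : (k.+1`! * m.+3`!)%:R != 0 :> rat.
  by rewrite pnatr_eq0 muln_eq0 negb_or -!lt0n !fact_gt0.
apply: (mulfI c0); rewrite mulrCA E !factS !natrM; by field.
Qed.

(** A critical vertex with a leg takes at least three half-edges. *)
Lemma stable_mass_rec_small N g n k m : (2 < 2 * g + n)%N -> (m < 2)%N ->
  n.+1%:R * stable_mass N g n.+1 k m.+1
  = (2 - (2 * g + n)%:R) * stable_mass N g n k m.
Proof.
move=> gn m2; have := stable_sum_leg N 'I_k 'I_m g n.
rewrite [X in _ + X]big1 => [|x /and3P[sx ll c]].
  rewrite !stable_massE !card_option !card_ord addr0 => E.
  have c0 : (k`! * m.+1`!)%:R != 0 :> rat.
    by rewrite pnatr_eq0 muln_eq0 negb_or -!lt0n !fact_gt0.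
  apply: (mulfI c0); by rewrite mulrCA E factS !natrM; ring.
have := critical_leg_valence gn sx ll c; set A := [set _ | _] => A2.
by have := max_card (mem A); rewrite A2 card_ord leqNgt m2.
Qed.

(** * From isomorphism classes to labelled graphs *)

Section Orbits.
Variables (N k m : nat).
Notation aT := ({perm 'I_k} * {perm 'I_m})%type.

Definition relabel_by (x : bgraph N 'I_k 'I_m) (a : aT) : bgraph N 'I_k 'I_m :=
  relabel a.1 (a.1^-1)%g (permK a.2) (permKV a.2) x.

Lemma relabel_by1 x : relabel_by x 1%g = x.
Proof. by apply: bgraphP => z; rewrite !mkE /= ?invg1 !perm1. Qed.

Lemma relabel_byM x a b :
  relabel_by x (a * b)%g = relabel_by (relabel_by x a) b.
Proof. by apply: bgraphP => z; rewrite !mkE /= invMg !permM. Qed.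

Canonical relabel_action := TotalAction relabel_by1 relabel_byM.

Lemma orbit_relabel (x y : bgraph N 'I_k 'I_m) :
  (y \in orbit relabel_action [set: aT] x) = boolp.asbool (isomorphic x y).
Proof.
apply/orbitP/boolp.asboolP => [[a _ <-]|].
  exists a.1, a.2; split.
  - by exists (a.1^-1)%g; [exact: permK|exact: permKV].
  - by exists (a.2^-1)%g; [exact: permK|exact: permKV].
  - exact: vertex_of_relabel.
  - exact: flip_relabel.
  - exact/vgenus_relabel/permK.
case=> f [h [bf bh vE oE gE]].
exists (perm (bij_inj bf), perm (bij_inj bh)); rewrite ?inE //=.
have fE v : f v = perm (bij_inj bf) v by rewrite permE.
have hE z : h z = perm (bij_inj bh) z by rewrite permE.
apply: bgraphP => z; rewrite mkE /=.
- by rewrite -fE -vE hE permKV.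
- by rewrite -hE -oE hE permKV.
- by apply: val_inj; rewrite /= -!vgenusE -gE fE permKV.
Qed.

Lemma stabilizer_relabel (x : bgraph N 'I_k 'I_m) :
  'C_[set: aT][x | relabel_action]%g = Aut_graph x.
Proof.
apply/setP => a; rewrite !inE sub1set inE /=.
apply/eqP/and3P => [E|[/forallP vE /forallP oE /forallP gE]].
  split; apply/forallP => z; apply/eqP.
  - by rewrite -{1}E vertex_of_relabel.
  - by rewrite -{1}E flip_relabel.
  - by rewrite -{1}E vgenus_relabel //; exact: permK.
apply: bgraphP => z; rewrite mkE.
- by rewrite -(eqP (vE _)) permKV.
- by rewrite -(eqP (oE _)) permKV.
- by apply: val_inj; rewrite /= -!vgenusE -(eqP (gE _)) permKV.
Qed.

(** The orbit-stabiliser theorem for the action of relabellings. *)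
Lemma card_labellings (x : bgraph N 'I_k 'I_m) :
  (#|[set y : bgraph N 'I_k 'I_m | boolp.asbool (isomorphic x y)]|
   * #|Aut_graph x| = k`! * m`!)%N.
Proof.
have := card_orbit_stab relabel_action [group of [set: aT]] x.
rewrite stabilizer_relabel cardsT card_prod !card_Sn => <-; congr (_ * _)%N.
by apply: eq_card => y; rewrite !inE orbit_relabel.
Qed.
End Orbits.

Definition class_of_graph k m (G : graph_on 'I_k 'I_m) : graph_class :=
  (\pi_graph_class (existT graph_type (k, m) G : fin_graph))%qT.

Lemma class_of_graph_eq k m (G : graph_on 'I_k 'I_m) c :
  (class_of_graph G == c)
  = boolp.asbool (isomorphic (tagged (class_repr c)) G).
Proof.
by rewrite -[c in LHS]reprK eq_sym (eqmodE iso_equiv).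
Qed.

Lemma isomorphic_stable_graph (V H V' H' : finType) (G : graph_on V H)
    (G' : graph_on V' H') g n :
  isomorphic G G' -> stable_graph g n G -> stable_graph g n G'.
Proof.
case=> f [h [bf bh vE oE gE]]; exact: (iso_stable_graph bf bh vE oE gE).
Qed.

Lemma isomorphic_vweight (V H V' H' : finType) (G : graph_on V H)
    (G' : graph_on V' H') : isomorphic G G' -> vweight G' = vweight G.
Proof. by case=> f [h [bf bh vE oE gE]]; exact: (iso_vweight bf bh vE gE). Qed.

Lemma isomorphic_card (V H V' H' : finType) (G : graph_on V H)
    (G' : graph_on V' H') : isomorphic G G' -> #|V| = #|V'| /\ #|H| = #|H'|.
Proof.
case=> f [h [bf bh _ _ _]].
by split; [exact: bij_eq_card bf|exact: bij_eq_card bh].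
Qed.

Lemma isomorphic_sym (V H V' H' : finType) (G : graph_on V H)
    (G' : graph_on V' H') : isomorphic G G' -> isomorphic G' G.
Proof.
case=> f [h [[f' fK f'K] [h' hK h'K] vE oE gE]].
exists f', h'; split.
- by exists f.
- by exists h.
- by move=> z; rewrite -{2}(h'K z) vE fK.
- by move=> z; rewrite -{2}(h'K z) oE hK.
- by move=> v; rewrite -{2}(f'K v) gE.
Qed.

Lemma in_Gc_class_of_graph g n k m (G : graph_on 'I_k 'I_m) :
  stable_graph g n G -> in_Gc g n (class_repr (class_of_graph G)).
Proof.
move=> sG; have := eqxx (class_of_graph G); rewrite {1}class_of_graph_eq.
move=> /boolp.asboolP/isomorphic_sym iG.
exact: (isomorphic_stable_graph iG sG).
Qed.

Lemma bgraph_of_graph N (V H : finType) (G : graph_on V H) :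
  (forall v, (vgenus G v <= N)%N) -> exists x : bgraph N V H, graph_of x = G.
Proof.
move=> bG.
exists (mk_bgraph (vertex_of G) (fun v => inord (vgenus G v)) (flipK G)).
apply: val_inj => /=; rewrite /graph_bdata /= [RHS]surjective_pairing.
rewrite [X in _ = (X, _)]surjective_pairing.
by congr (_, _, _); apply/ffunP => z; rewrite !ffunE // inordK // ltnS.
Qed.

Definition class_weight (c : graph_class) : rat :=
  vweight (tagged (class_repr c)) / #|Aut_graph (tagged (class_repr c))|%:R.

Lemma sum_labellings N g n k m (c : graph_class) :
  (3 * g + n <= N)%N -> in_Gc g n (class_repr c) ->
  \sum_(x : bgraph N 'I_k 'I_m | stable_graph g n x && (class_of_graph x == c))
      vweight x
  = if tag (class_repr c) == (k, m) then (k`! * m`!)%:R * class_weight c else 0.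
Proof.
move=> gN; under eq_bigl do rewrite class_of_graph_eq.
rewrite /class_weight; move: (class_repr c) => [[k' m'] G] /= cG.
case: eqP => [[kk mm]|ne]; last first.
  rewrite big1 // => x /andP[_ /boolp.asboolP/isomorphic_card].
  by rewrite !card_ord => -[? ?]; case: ne; congr (_, _).
subst k' m'.
have [x0 x0E] : exists x : bgraph N 'I_k 'I_m, graph_of x = G.
  apply: bgraph_of_graph => v; have [_ _ /(_ v)] := in_Gc_bounds cG.
  by rewrite /=; lia.
rewrite -x0E in cG *.
transitivity (\sum_(x in [set y : bgraph N 'I_k 'I_m |
    boolp.asbool (isomorphic x0 y)]) vweight x0).
  apply: eq_big => x; last by case/andP=> _ /boolp.asboolP/isomorphic_vweight.
  rewrite inE andbC; case: boolp.asboolP => //= i0.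
  exact: isomorphic_stable_graph i0 cG.
rewrite sumr_const -(card_labellings x0) natrM -[LHS]mulr_natl -mulrA.
congr (_ * _); rewrite mulrC mulfVK //.
rewrite pnatr_eq0 -lt0n; apply/card_gt0P; exists (1%g, 1%g).
by rewrite inE; apply/and3P; split; apply/forallP => z; rewrite /= !perm1.
Qed.

Lemma stable_mass_classes N g n k m : (3 * g + n <= N)%N ->
  stable_mass N g n k m
  = \sum_(c <- finmap.enum_fset (cardinality.fset_set (Gc g n))
       | tag (class_repr c) == (k, m)) class_weight c.
Proof.
move=> gN; apply: (mulIf (x := (k`! * m`!)%:R)).
  by rewrite pnatr_eq0 muln_eq0 negb_or -!lt0n !fact_gt0.
rewrite mulfVK; last by rewrite pnatr_eq0 muln_eq0 negb_or -!lt0n !fact_gt0.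
set s := finmap.enum_fset _.
have sP c : (c \in s) = in_Gc g n (class_repr c).
  rewrite cardinality.in_fset_set; last exact: finite_Gc.
  by apply/idP/idP; rewrite classical_sets.in_setE.
transitivity (\sum_(x : bgraph N 'I_k 'I_m | stable_graph g n x)
    \sum_(c <- s | class_of_graph x == c) vweight x).
  apply: eq_bigr => x sx.
  rewrite -big_filter (_ : [seq c <- s | _] = [:: class_of_graph (graph_of x)]).
    by rewrite big_seq1.
  rewrite -(@filter_pred1_uniq _ s (class_of_graph (graph_of x))).
  - by apply: eq_filter => c; rewrite /= eq_sym.
  - exact: finmap.fset_uniq.
  - by rewrite sP in_Gc_class_of_graph.
rewrite (exchange_big_dep xpredT) //= mulr_suml [RHS]big_mkcond /=.
rewrite [RHS]big_seq_cond [LHS]big_seq_cond.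
apply: eq_bigr => c; rewrite andbT sP => cG; rewrite sum_labellings //.
by case: ifP => _; rewrite ?mul0r // mulrC.
Qed.

(** * The recursion for the coefficients *)

Lemma prod_exprz (F : fieldType) (t : F) (I : finType) (e : I -> int) :
  t != 0 -> \prod_i t ^ e i = t ^ (\sum_i e i).
Proof.
move=> t0; elim/big_rec2: _ => [|i x y _ ->]; first by rewrite expr0z.
by rewrite expfzDr.
Qed.

(** The exponent of t is the sum over the vertices of 2 - 2g_v - val_v, the
    Euler characteristic of the surface that the graph describes. *)
Lemma graph_weightE (F : fieldType) (iota : {rmorphism rat -> F}) (t : F) g n
    (G : fin_graph) : t != 0 -> in_Gc g n G ->
  graph_weight t G
  = (t ^ (2 - (2 * g + n)%:Z)
     * iota (vweight (tagged G) / #|Aut_graph (tagged G)|%:R))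
    *: 'X^#|edges (tagged G)|.
Proof.
move=> t0 /and4P[_ _]; rewrite genusE => gG /eqP nG; congr (_ *: _).
rewrite big_split /= prod_exprz // mulrA [RHS]mulrC; congr (_ * t ^ _).
  rewrite fmorph_div /= rmorph_nat mulrC rmorph_prod. congr (_ / _).
  by apply: eq_bigr => v _; rewrite fmorph_eq_rat.
have := sum_stability (tagged G); move: gG; rewrite nG.
rewrite (eq_bigr (fun v =>
    2 - (2 * vgenus (tagged G) v + valence (tagged G) v)%N%:Z));
  last by move=> v _; rewrite PoszD PoszM opprD addrA.
rewrite sumrB -[X in _ - X](big_morph Posz PoszD erefl) sumr_const card_ord.
move=> /eqP gG ->.
move: gG; rewrite !card_ord; move: (\sum_v vgenus _ v)%N => S.
by move: (tag G).1 (tag G).2 => k m; lia.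
Qed.

(** A graph with n legs and i internal edges has 2i + n half-edges. *)
Lemma chi_coef (F : fieldType) (iota : {rmorphism rat -> F}) (t : F) g n i :
  t != 0 ->
  (chi t g n)`_i = t ^ (2 - (2 * g + n)%:Z) * iota
    (\sum_(c <- finmap.enum_fset (cardinality.fset_set (Gc g n))
       | (tag (class_repr c)).2 == (2 * i + n)%N) class_weight c).
Proof.
move=> t0; rewrite /chi fsbigop.fsbig_finite; last exact: finite_Gc.
rewrite rmorph_sum mulr_sumr coef_sum [RHS]big_mkcond big_seq [RHS]big_seq /=.
apply: eq_bigr => c; rewrite cardinality.in_fset_set; last exact: finite_Gc.
rewrite classical_sets.in_setE => cG; rewrite (graph_weightE iota t0 cG).
have -> : ((tag (class_repr c)).2 == (2 * i + n)%N)
    = (i == #|edges (tagged (class_repr c))|).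
  have := card_halfedges (tagged (class_repr c)); rewrite card_ord.
  case/and4P: cG => _ _ _ /eqP ->; move: #|edges _| => E.
  by move: (tag _).2 => m mE; apply/eqP/eqP; lia.
rewrite coefZ coefXn /class_weight.
by case: eqP => _; rewrite ?mulr1 ?mulr0.
Qed.

Lemma tchi_coef N g n K i : (3 * g + n <= N)%N -> (2 * g + n <= K)%N ->
  (tchi g n)`_i = \sum_(k < K) stable_mass N g n k (2 * i + n).
Proof.
move=> gN gK; rewrite /tchi (@chi_coef _ idfun) ?oner_eq0 // exp1rz mul1r /=.
under [RHS]eq_bigr do rewrite stable_mass_classes //.
rewrite (exchange_big_dep xpredT) //= [LHS]big_mkcond.
rewrite big_seq [RHS]big_seq; apply: eq_bigr => c.
rewrite cardinality.in_fset_set; last exact: finite_Gc.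
rewrite classical_sets.in_setE => /in_Gc_bounds[+ _ _].
case: (class_repr c) => [[k m] G] /=; rewrite card_ord => kK.
have kK' : (k < K)%N by lia.
rewrite big_mkcond (bigD1 (Ordinal kK')) //= big1 ?addr0 => [|j jk].
  by rewrite xpair_eqE eqxx.
by rewrite xpair_eqE; case: eqP => // kj; case/eqP: jk; apply: val_inj.
Qed.

Lemma stable_mass_few_halfedges N g n k m :
  (m < n)%N -> stable_mass N g n k m = 0.
Proof.
move=> mn; rewrite /stable_mass /stable_sum big1 ?mul0r // => x /and4P[_ _ _].
move/eqP=> nE; have := max_card (mem (legs (graph_of x))).
by rewrite nE card_ord leqNgt mn.
Qed.

Lemma tchi_coef_rec g n i : (2 < 2 * g + n)%N ->
  n.+1%:R * (tchi g n.+1)`_i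
  = (2 - (2 * g + n)%:R) * (tchi g n)`_i
    + (if i is j.+1 then (n + j)%:R * (tchi g n)`_j else 0).
Proof.
move=> gn; pose N := (3 * g + n.+1)%N; pose K := (2 * g + n.+1)%N.
have coef m j k := @tchi_coef N g m k j.
rewrite !(coef _ _ K.+1) ?/N ?/K //; try lia.
(* The term with no vertex drops out, which shifts k on the left to k + 1. *)
rewrite !big_ord_recl !stable_mass_no_vertex !add0r !mulr_sumr.
have -> : (if i is j.+1 then (n + j)%:R * (tchi g n)`_j else 0)
    = \sum_(k < K) (if i is j.+1
        then (n + j)%:R * stable_mass N g n k (2 * j + n) else 0).
  case: i => [|j]; first by rewrite big1.
  by rewrite (coef _ _ K) ?/N ?/K ?mulr_sumr //; lia.
rewrite -big_split; apply: eq_bigr => k _ /=; rewrite /bump /= add1n.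
case: i => [|j].
  rewrite muln0 !add0n addr0; have [n2|n2] := ltnP n 2.
    by rewrite stable_mass_rec_small.
  (* Graphs with n legs have at least n half-edges, so the second term of the
     recursion vanishes. *)
  have := stable_mass_rec N k (n - 2) gn.
  rewrite (stable_mass_few_halfedges _ _ _ (m := n - 2)); last by lia.
  have -> : ((n - 2).+3 = n.+1)%N by lia.
  have -> : ((n - 2).+2 = n)%N by lia.
  by rewrite mulr0 addr0.
have -> : (2 * j.+1 + n.+1 = (2 * j + n).+3)%N by lia.
have -> : (2 * j.+1 + n = (2 * j + n).+2)%N by lia.
rewrite stable_mass_rec //; congr (_ + _ * _).
have -> : (2 * j + n + n = 2 * (n + j))%N by lia.
by rewrite mulnC natrM mulfK.
Qed.

(** * The differential equation *)

Definition ratQt : {rmorphism rat -> Qt} :=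
  GRing.RMorphism.clone rat Qt (@FracField.tofrac {poly rat} \o polyC) _.

Lemma tvar_neq0 : tvar != 0.
Proof. by rewrite /tvar tofrac_eq0 polyX_eq0. Qed.

Lemma fderiv0 : fderiv 0 = 0.
Proof.
have := @fderivE 0 1 (oner_neq0 _).
by rewrite tofrac0 mul0r => ->; rewrite derivE !mul0r subr0 tofrac0 mul0r.
Qed.

Lemma quotient_rule_monomial (F : fieldType) (T A : F) m : T != 0 ->
  - (A * (T ^+ m *+ m.+1)) / T ^+ m.+1 ^+ 2
  = (- m.+1%:Z)%:~R / T ^+ m.+2 * A.
Proof.
move=> T0; have P0 := expf_neq0 m T0; rewrite mulrNz -pmulrn -mulr_natl.
by rewrite !exprS expr0; field; rewrite T0 P0.
Qed.

Lemma fderiv_monomial (e : int) (a : rat) : e < 0 ->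
  fderiv (tvar ^ e * ratQt a) = e%:~R * tvar ^ (e - 1) * ratQt a.
Proof.
case: e => // m _; rewrite NegzE -opprD -PoszD -!exprnN addn1.
have -> : tvar ^- m.+1 * ratQt a
    = FracField.tofrac a%:P / FracField.tofrac 'X^(m.+1).
  by rewrite tofracXn mulrC.
rewrite fderivE ?monic_neq0 ?monicXn // derivC mul0r sub0r derivXn.
rewrite tofracN tofracM tofracMn !tofracXn /= -/tvar.
exact: quotient_rule_monomial tvar_neq0.
Qed.

Lemma chi_tk_coef g n i :
  (chi_tk g n)`_i = tvar ^ (2 - (2 * g + n)%:Z) * ratQt (tchi g n)`_i.
Proof.
rewrite /chi_tk (chi_coef ratQt _ _ _ tvar_neq0) /tchi.
by rewrite (@chi_coef _ idfun) ?oner_eq0 // exp1rz mul1r.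
Qed.

Lemma acoefE g n i : (2 < 2 * g + n)%N -> acoef g n i%:Z = (tchi g n)`_i.
Proof.
move=> gn; rewrite /acoef /=; case: ifP => // iN.
by rewrite nth_default // (leq_trans (size_tchi g n)) //; move: iN; lia.
Qed.

Theorem theorem3p7 (g n : nat) (hgn : (2 < 2 * g + n)%N) :
  Dop n (chi_tk g n) = (n.+1)%:R * chi_tk g n.+1
  /\ (forall i : nat,
        (n.+1)%:R * acoef g n.+1 i%:Z
        = (2 - 2 * g%:R - n%:R) * acoef g n i%:Z
          + (n%:R + i%:R - 1) * acoef g n (i%:Z - 1)).
Proof.
have rec i := @tchi_coef_rec g n i hgn.
split; last first.
  move=> i; rewrite !acoefE //; last by lia.
  rewrite rec natrD natrM opprD addrA; congr (_ + _).
  case: i => [|j]; first by rewrite /acoef /= mulr0.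
  by rewrite -addn1 PoszD addrK acoefE // natrD; ring.
apply/polyP => i; rewrite /Dop /D_t /D_kappa.
rewrite -![_ * _%:P * _]mulrA -[n%:R * _ * _]mulrA !mulr_natl !coefD !coefMn.
rewrite coef_map_id0 ?fderiv0 // coefXnM coefXM !coefCM coef_deriv !chi_tk_coef.
rewrite fderiv_monomial; last by lia.
have -> : 2 - (2 * g + n.+1)%:Z = 2 - (2 * g + n)%:Z - 1 by lia.
move: ratQt => iota; have recQ := congr1 iota (rec i).
rewrite rmorphM rmorph_nat rmorphD mulr_natl in recQ.
rewrite -[RHS]mulrnAr recQ mulrDr {recQ}.
set e := 2 - (2 * g + n)%:Z; have T0 := tvar_neq0.
have Te x : tvar^-1 * (tvar ^ e * x) = tvar ^ (e - 1) * x.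
  by rewrite mulrA [_^-1 * _]mulrC (expfzDr e (- 1)) // exprN1.
rewrite -addrA; congr (_ + _).
  rewrite rmorphM mulrCA mulrA; congr (_ * _ * _).
  by rewrite /e rmorphB rmorphB !rmorph_nat.
case: i => [|[|j]].
- by rewrite rmorph0 mulr0 mul0rn addr0.
- by rewrite add0r Te rmorphM rmorph_nat addn0 -mulrnAr mulr_natl.
rewrite !subSS subn0 /=.
by rewrite !mulrnAr !Te rmorphM rmorph_nat mulr_natl mulrnAr (addnC n) mulrnDr.
Qed.
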